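(* For all integers $t \geq 2$ and $k \geq 1$, there exists a $P_t$-free graph $G$ with $\mathrm{td}_2(G) \leq k$ such that \[ \mathrm{td}(G) \geq \binom{\lfloor (t-1)/2 \rfloor + k - 1}{\lfloor (t-1)/2 \rfloor}. \]
   Context: Graphs are finite and simple; the null graph has no vertices; connected graphs have at least one vertex. $P_t$ denotes the path on $t$ vertices. A graph $G$ is $H$-free if $G$ does not contain $H$ as an induced subgraph. A cut-vertex of a graph $G$ is a vertex $v$ such that $G-v$ has more components than $G$. A block of $G$ is a maximal connected subgraph of $G$ without a cut-vertex (so blocks are maximal 2-connected subgraphs, cut edges with their endpoints, or isolated vertices). ''$G$ is a block'' means that $G$ is connected and has no cut-vertex. Treedepth $\mathrm{td}(G)$ is defined recursively: $\mathrm{td}(G)=0$ if $G$ is the null graph; $\mathrm{td}(G)=\min_{v\in V(G)}\mathrm{td}(G-v)+1$ if $G$ is connected; $\mathrm{td}(G)=\max_i \mathrm{td}(C_i)$ if $G$ has components $C_1,\dots,C_m$ with $m>1$. 2-treedepth $\mathrm{td}_2(G)$ is defined recursively: $\mathrm{td}_2(G)=0$ if $G$ is the null graph; $\mathrm{td}_2(G)=\min_{v\in V(G)}\mathrm{td}_2(G-v)+1$ if $G$ is a block; $\mathrm{td}_2(G)=\max_i \mathrm{td}_2(B_i)$ if $G$ has blocks $B_1,\dots,B_m$ with $m>1$. *)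

(* Defs.v *)
From mathcomp Require Import all_boot.
Set Implicit Arguments.
Unset Strict Implicit.
Unset Printing Implicit Defensive.

Record sgraph := SGraph {
  vertex :> finType;
  adj : rel vertex;
  adj_sym : symmetric adj;
  adj_irrefl : irreflexive adj }.

Definition path_rel t : rel 'I_t :=
  [rel i j : 'I_t | (i.+1 == j) || (j.+1 == i)].

Lemma path_rel_sym t : symmetric (@path_rel t).
Proof. by move=> i j; apply: orbC. Qed.

Lemma path_rel_irrefl t : irreflexive (@path_rel t).
Proof. by move=> i; rewrite /path_rel /= orbb gtn_eqF ?ltnSn. Qed.

Definition path_graph t := SGraph (@path_rel_sym t) (@path_rel_irrefl t).

Definition has_induced (H G : sgraph) : Prop :=
  exists2 f : H -> G, injective f & forall x y, adj (f x) (f y) = adj x y.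

Definition free (H G : sgraph) : Prop := ~ has_induced H G.

(* The induced subgraph G[A] is represented by the vertex set A; every notion
   below is about G[A], where e is the adjacency relation of G. *)
Section Induced.
Variables (T : finType) (e : rel T).
Implicit Types A B C : {set T}.

Definition induced A : rel T := [rel x y | [&& x \in A, y \in A & e x y]].

Definition components A : {set {set T}} :=
  equivalence_partition (connect (induced A)) A.

Definition connected A := #|components A| == 1.

Definition cut_vertex A v :=
  (v \in A) && (#|components A| < #|components (A :\ v)|).

Definition is_block A := connected A && [forall v, ~~ cut_vertex A v].

(* It is enough to consider induced subgraphs: adding edges to a subgraph on
   the same vertex set preserves is_block, see is_block_subrel. *)
Definition blocks A : {set {set T}} :=
  [set B | maxset (fun C => (C \subset A) && is_block C) B].

End Induced.

(* The recursion scheme common to treedepth and 2-treedepth: delete a vertex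
   when atom A holds, otherwise decompose A into pieces. Fuel n suffices when
   #|A| <= n, and the default #|A| of the minimum is at least every other term,
   so neither affects the value: see depth_recE, depth_atom, depth_pieces. *)
Section Depth.
Variables (T : finType) (atom : pred {set T}).
Variable (pieces : {set T} -> {set {set T}}).
Implicit Types A C : {set T}.

Fixpoint depth_rec n A : nat :=
  if n is n'.+1 then
    if A == set0 then 0
    else if atom A then (\big[minn/#|A|]_(v in A) depth_rec n' (A :\ v)).+1
    else \max_(C in pieces A) depth_rec n' C
  else 0.

Definition depth A := depth_rec #|A| A.

Lemma bigminn_le m (F : T -> nat) A v :
  v \in A -> \big[minn/m]_(u in A) F u <= F v.
Proof.
move=> vA; elim: (index_enum T) (mem_index_enum v) => // u s IHs.
rewrite inE big_cons => /predU1P[<-|/IHs le]; first by rewrite vA geq_minl.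
by case: ifP => // _; rewrite geq_min le orbT.
Qed.

Hypothesis piecesP :
  forall A C, A != set0 -> ~~ atom A -> C \in pieces A -> C \proper A.

Lemma depth_rec_card n A : depth_rec n A <= #|A|.
Proof.
elim: n A => //= n IHn A; case: eqP => // /eqP A0.
case: ifP => [_|/negbT aA].
  have /set0Pn[v vA] := A0.
  rewrite [leqRHS](cardsD1 v A) vA add1n ltnS.
  exact: leq_trans (bigminn_le _ _ vA) (IHn _).
apply/bigmax_leqP => C CA; apply: leq_trans (IHn C) _.
by rewrite subset_leq_card // proper_sub // (piecesP A0).
Qed.

Lemma depth_recE n A : #|A| <= n -> depth_rec n A = depth A.
Proof.
move=> leAn; have [m ltAm] := ubnP #|A|; elim: m n A leAn ltAm => // m IHm n A.
have [->|A0] := eqVneq A set0.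
  by move=> _ _; rewrite /depth cards0; case: n => //= n; rewrite eqxx.
have [a Ea] : {a | #|A| = a.+1} by exists #|A|.-1; rewrite prednK ?card_gt0.
rewrite /depth Ea; case: n => // n; rewrite !ltnS /= (negPf A0) => lean ltam.
have eq_rec C : #|C| <= a -> depth_rec n C = depth_rec a C.
  move=> leCa; have ltCm := leq_ltn_trans leCa ltam.
  by rewrite (IHm n) ?(IHm a) // (leq_trans leCa).
case: ifP => [_|/negbT aA].
  congr _.+1; apply: eq_bigr => v vA; apply: eq_rec.
  by move: Ea; rewrite (cardsD1 v) vA => -[<-].
apply: eq_bigr => C CA; apply: eq_rec.
by rewrite -ltnS -Ea proper_card // (piecesP A0).
Qed.

Lemma depth0 : depth set0 = 0.
Proof. by rewrite /depth cards0. Qed.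

Lemma depth_atom A : A != set0 -> atom A ->
  (exists2 v, v \in A & depth A = (depth (A :\ v)).+1) /\
  (forall v, v \in A -> depth A <= (depth (A :\ v)).+1).
Proof.
move=> A0 aA.
have -> : depth A = (\big[minn/#|A|]_(v in A) depth (A :\ v)).+1.
  rewrite -(@depth_recE #|A|.+1) //= (negPf A0) aA; congr _.+1.
  by apply: eq_bigr => v _; rewrite depth_recE // subset_leq_card // subD1set.
have min_le v : v \in A ->
    \big[minn/#|A|]_(u in A) depth (A :\ u) <= depth (A :\ v).
  exact: bigminn_le.
split=> [|v vA]; last by rewrite ltnS min_le.
have [v0 v0A] := set0Pn _ A0.
case: (arg_minnP (fun v => depth (A :\ v)) v0A) => v vA vmin; exists v => //.
congr _.+1; apply/eqP; rewrite eqn_leq min_le //=.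
elim/big_ind: _ => [|m n lem len|u uA]; last exact: vmin.
  rewrite (leq_trans (depth_rec_card _ _)) // subset_leq_card //.
  exact: subD1set.
by rewrite leq_min lem.
Qed.

Lemma depth_pieces A : A != set0 -> ~~ atom A ->
  depth A = \max_(C in pieces A) depth C.
Proof.
move=> A0 aA; rewrite -(@depth_recE #|A|.+1) //= (negPf A0) (negPf aA).
apply: eq_bigr => C CA; rewrite depth_recE // subset_leq_card // proper_sub //.
exact: piecesP A0 aA CA.
Qed.

End Depth.

Definition td_in (T : finType) (e : rel T) : {set T} -> nat :=
  depth (connected e) (components e).
Definition td2_in (T : finType) (e : rel T) : {set T} -> nat :=
  depth (is_block e) (blocks e).

Definition td (G : sgraph) : nat := td_in (@adj G) [set: G].
Definition td2 (G : sgraph) : nat := td2_in (@adj G) [set: G].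

(* Sanity of the encodings: the recursion equations of treedepth and
   2-treedepth, and the reduction of blocks to induced subgraphs. *)
Section Recursion.
Variable T : finType.
Implicit Types (e f : rel T) (A B C : {set T}).

Lemma connect_equiv e A : symmetric e ->
  {in A & &, equivalence_rel (connect (induced e A))}.
Proof.
move=> e_sym x y z _ _ _; split; first exact: connect0.
move=> xy; apply: same_connect xy z; apply: sym_connect_sym => u v /=.
by rewrite /induced /= e_sym andbCA.
Qed.

Lemma components_partition e A :
  symmetric e -> partition (components e A) A.
Proof. by move=> e_sym; apply/equivalence_partitionP/connect_equiv. Qed.

Lemma components_eq0 e A :
  symmetric e -> (components e A == set0) = (A == set0).
Proof.
move=> e_sym; apply/eqP/eqP => [c0|->]; last exact: imset0.
have /and3P[/eqP<- _ _] := components_partition A e_sym.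
by rewrite c0 /cover big_set0.
Qed.

Lemma components_le1P e A : symmetric e ->
  reflect {in A &, forall x y, connect (induced e A) x y}
          (#|components e A| <= 1).
Proof.
move=> e_sym; apply: (iffP card_le1_eqP) => [cA x y xA yA|cA X Y].
  have /and3P[/eqP cov _ _] := components_partition A e_sym.
  have yx : y \in pblock (components e A) x.
    suff -> : pblock (components e A) x = pblock (components e A) y.
      by rewrite mem_pblock cov.
    by apply: cA; rewrite pblock_mem ?cov.
  by move: yx; rewrite pblock_equivalence_partition //; apply: connect_equiv.
by case/imsetP=> x xA -> /imsetP[y yA ->]; apply/setP => z; rewrite !inE;
   case zA: (z \in A) => //=; rewrite !cA.
Qed.

Lemma connectedE e A : symmetric e ->
  connected e A = (A != set0) && (#|components e A| <= 1).
Proof.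
by move=> e_sym; rewrite /connected eqn_leq card_gt0 components_eq0 // andbC.
Qed.

Lemma components_le1_subrel e f A : symmetric e -> symmetric f -> subrel f e ->
  #|components f A| <= 1 -> #|components e A| <= 1.
Proof.
move=> e_sym f_sym fe /(components_le1P _ f_sym) cf.
apply/components_le1P => // x y xA yA; apply: connect_sub (cf x y xA yA).
by move=> u v /and3P[uA vA /fe uv]; apply: connect1; rewrite /induced /= uA vA.
Qed.

Lemma is_block_subrel e f B : symmetric e -> symmetric f -> subrel f e ->
  is_block f B -> is_block e B.
Proof.
move=> e_sym f_sym fe /andP[cB /forallP ncB].
have ceB : connected e B.
  move: cB; rewrite !connectedE // => /andP[-> /=].
  exact: components_le1_subrel.
rewrite /is_block ceB; apply/forallP => v; move: (ncB v).
rewrite /cut_vertex (eqP cB) (eqP ceB); case: (v \in B) => //=.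
by rewrite -!leqNgt; apply: components_le1_subrel.
Qed.

Lemma components_proper e A C : symmetric e ->
  A != set0 -> ~~ connected e A -> C \in components e A -> C \proper A.
Proof.
move=> e_sym A0 ncA CA; have pA := components_partition A e_sym.
have /and3P[/eqP cov tI n0] := pA.
rewrite properEneq -{2}cov bigcup_sup // andbT; apply: contra ncA => /eqP EC.
rewrite EC in CA; rewrite /connected; apply/cards1P; exists A.
apply/setP => D; rewrite inE; apply/idP/eqP => [DA|-> //].
have /set0Pn[x xD] : D != set0 by apply: contraNneq n0 => <-.
have xA : x \in A by rewrite -cov; apply/bigcupP; exists D.
by rewrite -(def_pblock tI DA xD) (def_pblock tI CA xA).
Qed.

Lemma blocks_proper e A B :
  A != set0 -> ~~ is_block e A -> B \in blocks e A -> B \proper A.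
Proof.
move=> _ nbA; rewrite inE => /maxsetp/andP[BA bB].
by rewrite properEneq BA andbT; apply: contraNneq nbA => <-.
Qed.

Lemma is_block_set1 e v : symmetric e -> is_block e [set v].
Proof.
move=> e_sym; have c1 : connected e [set v].
  rewrite connectedE // -card_gt0 cards1 /=.
  by apply/components_le1P => // x y /set1P-> /set1P->; apply: connect0.
rewrite /is_block c1; apply/forallP => w; rewrite /cut_vertex negb_and -leqNgt.
rewrite (eqP c1) in_set1; case: eqP => //= ->; rewrite setDv.
by apply/components_le1P => // x y; rewrite inE.
Qed.

Lemma td_in0 e : td_in e set0 = 0.
Proof. exact: depth0. Qed.

Lemma td_in_connected e A : symmetric e -> connected e A ->
  (exists2 v, v \in A & td_in e A = (td_in e (A :\ v)).+1) /\
  (forall v, v \in A -> td_in e A <= (td_in e (A :\ v)).+1).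
Proof.
move=> e_sym cA; apply: depth_atom => //.
  by move=> ? ?; apply: components_proper.
by move: cA; rewrite connectedE // => /andP[].
Qed.

Lemma td_in_components e A : symmetric e -> 1 < #|components e A| ->
  td_in e A = \max_(C in components e A) td_in e C.
Proof.
move=> e_sym cA; apply: depth_pieces.
  by move=> ? ?; apply: components_proper.
  by rewrite -(components_eq0 _ e_sym) -card_gt0 ltnW.
by rewrite /connected gtn_eqF.
Qed.

Lemma td2_in0 e : td2_in e set0 = 0.
Proof. exact: depth0. Qed.

Lemma td2_in_block e A : symmetric e -> is_block e A ->
  (exists2 v, v \in A & td2_in e A = (td2_in e (A :\ v)).+1) /\
  (forall v, v \in A -> td2_in e A <= (td2_in e (A :\ v)).+1).
Proof.
move=> e_sym bA; apply: depth_atom => //; first exact: blocks_proper.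
by case/andP: bA; rewrite connectedE // => /andP[].
Qed.

Lemma blocks_gt1 e A : symmetric e ->
  (1 < #|blocks e A|) = (A != set0) && ~~ is_block e A.
Proof.
move=> e_sym; apply/idP/andP => [c|[A0 nbA]].
  split.
    apply: contraTneq c => ->; rewrite -leqNgt.
    apply/card_le1_eqP => B C; rewrite !inE.
    move=> /maxsetp/andP[/[!subset0]/eqP-> _].
    by move=> /maxsetp/andP[/[!subset0]/eqP-> _].
  apply: contraTN c => bA; rewrite -leqNgt; apply/card_le1_eqP => B C.
  suff uA D : D \in blocks e A -> D = A by move=> /uA-> /uA->.
  rewrite inE => /maxsetP[/andP[DA _] /(_ A)] /=.
  by rewrite subxx bA => /(_ isT DA).
rewrite ltnNge; apply: contra nbA => /card_le1_eqP u.
have cov v : v \in A -> exists2 B, B \in blocks e A & v \in B.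
  move=> vA; pose P := [pred C : {set T} | (C \subset A) && is_block e C].
  have [|B mB vB] := @maxset_exists _ P [set v].
    by rewrite /= sub1set vA is_block_set1.
  by exists B; rewrite ?inE // -sub1set.
have [v /cov[B BA vB]] := set0Pn _ A0.
suff <- : B = A by move: BA; rewrite inE => /maxsetp/andP[].
apply/eqP; rewrite eqEsubset; apply/andP; split.
  by move: BA; rewrite inE => /maxsetp/andP[].
by apply/subsetP => w /cov[C CA wC]; rewrite (u C B).
Qed.

Lemma td2_in_blocks e A : symmetric e -> 1 < #|blocks e A| ->
  td2_in e A = \max_(B in blocks e A) td2_in e B.
Proof.
move=> e_sym; rewrite blocks_gt1 // => /andP[A0 nbA].
by apply: depth_pieces => //; apply: blocks_proper.
Qed.

End Recursion.

(* Main.v *)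
(* The extremal graphs realise Pascal's rule by coronas, where the corona of H
   and G joins every vertex of H to all vertices of its own copy of G. Treedepth
   is superadditive: as long as some connected part C of H survives in the
   elimination, so does a connected graph containing all copies of G at C, and a
   single vertex of H together with its copy of G has treedepth above td G.
   Blocks of the corona lie in H or in one vertex h of H plus its copy of G, and
   in the latter case deleting h leaves a subgraph of G, so td2 of the corona is
   at most max (td2 H) (td2 G + 1). An induced path that visits H leaves it
   only at its end vertices, so it has at most two vertices more than an induced
   path of H; otherwise it is an induced path of G. *)
Require Import Defs.
From mathcomp Require Import all_boot.
From mathcomp Require Import zify.
Set Implicit Arguments.
Unset Strict Implicit.
Unset Printing Implicit Defensive.

(** * Monotonicity of recursively defined depths *)

Section DepthMonotone.
Variables (T : finType) (atom : pred {set T}).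
Variable (pieces : {set T} -> {set {set T}}).
Implicit Types A B C D : {set T}.

Hypothesis pieces_proper :
  forall A C, A != set0 -> ~~ atom A -> C \in pieces A -> C \proper A.
Hypothesis pieces_atom : forall A C, C \in pieces A -> atom C.
Hypothesis atom_sub_piece : forall A C, atom C -> C \subset A ->
  exists2 D, D \in pieces A & C \subset D.
Hypothesis atom_neq0 : forall A, atom A -> A != set0.

Local Notation dep := (depth atom pieces).

(** If [A] is no atom, each of its pieces is compared with [B]; if only [B] is no atom, [A] lies in
    one piece of [B]. If both are atoms, the optimal vertex of [B] is deleted from both sets, or
    from [B] alone when it misses [A]. *)
Lemma depth_mono A B : A \subset B -> dep A <= dep B.
Proof.
have [n] := ubnP (#|A| + #|B|); elim: n A B => // n IHn A B /ltnSE ltn AB.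
have [->|A0] := eqVneq A set0; first by rewrite depth0.
have B0 : B != set0 by apply: contraNneq A0 => B0; rewrite -subset0 -B0.
have [aA|naA] := boolP (atom A); last first.
  rewrite (depth_pieces pieces_proper) //.
  apply/bigmax_leqP => C CA; have pCA := pieces_proper A0 naA CA.
  apply: IHn; last exact: subset_trans (proper_sub pCA) AB.
  by apply: leq_trans ltn; rewrite ltn_add2r proper_card.
have [aB|naB] := boolP (atom B); last first.
  have [D DB AD] := atom_sub_piece aA AB.
  have pDB := pieces_proper B0 naB DB.
  rewrite (depth_pieces pieces_proper B0 naB).
  apply: leq_trans (leq_bigmax_cond _ DB); apply: IHn AD.
  by apply: leq_trans ltn; rewrite ltn_add2l proper_card.
have [[v vB dB] _] := depth_atom pieces_proper B0 aB.
have cB : #|B :\ v| < #|B| by rewrite [ltnRHS](cardsD1 v) vB.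
rewrite dB; have [vA|vA] := boolP (v \in A).
  have [_ /(_ v vA) dA] := depth_atom pieces_proper A0 aA.
  apply: leq_trans dA _; rewrite ltnS; apply: IHn; last exact: setSD.
  apply: leq_trans ltn.
  by rewrite (cardsD1 v A) vA add1n addSn !ltnS leq_add2l ltnW.
apply: leqW; apply: IHn; last by rewrite subsetD1 AB.
by apply: leq_trans ltn; rewrite ltn_add2l.
Qed.

Lemma depth_gt0 A C : atom C -> C \subset A -> 0 < dep A.
Proof.
move=> aC CA; apply: leq_trans (depth_mono CA).
by have [[v _]] := depth_atom pieces_proper (atom_neq0 aC) aC=> ->.
Qed.

(** Trades the recursion for induction on the bound [n]. Since [C] ranges over all atoms inside [A],
    applications never have to determine [pieces A]; monotonicity makes the stronger condition
    equivalent. *)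
Lemma depth_leS n A :
  dep A <= n.+1 <->
  forall C, C \subset A -> atom C -> exists2 v, v \in C & dep (C :\ v) <= n.
Proof.
split=> [dA C CA aC|H].
  have [[v vC dC] _] := depth_atom pieces_proper (atom_neq0 aC) aC.
  by exists v => //; rewrite -ltnS -dC (leq_trans (depth_mono CA)).
have atom_le C : C \subset A -> atom C -> dep C <= n.+1.
  move=> CA aC; have [v vC dv] := H C CA aC.
  have [_ /(_ v vC) dC] := depth_atom pieces_proper (atom_neq0 aC) aC.
  exact: leq_trans dC _.
have [->|A0] := eqVneq A set0; first by rewrite depth0.
have [aA|naA] := boolP (atom A); first exact: atom_le.
rewrite (depth_pieces pieces_proper) //; apply/bigmax_leqP => C CA.
apply: atom_le (pieces_atom CA).
exact: proper_sub (pieces_proper A0 naA CA).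
Qed.

Lemma depth_setD1 A v : dep A <= (dep (A :\ v)).+1.
Proof.
apply/depth_leS => C CA aC; have [vC|vC] := boolP (v \in C).
  by exists v => //; apply: depth_mono; apply: setSD.
have /set0Pn[u uC] := atom_neq0 aC; exists u => //; apply: depth_mono.
(* Here [C] avoids [v], so it already lies in [A :\ v] and any vertex of [C] may be deleted. *)
by apply: subset_trans (subsetDl _ _) _; rewrite subsetD1 CA.
Qed.

End DepthMonotone.

(** * Connectedness and blocks through closed predicates *)

Section Connectivity.
Variables (T : finType) (e : rel T).
Hypothesis e_sym : symmetric e.
Implicit Types A B C D : {set T}.

(* The empty set is unseparated, but not connected. *)
Definition unseparated A := forall (S : pred T) x, x \in A -> S x ->
  (forall u v, u \in A -> v \in A -> e u v -> S u -> S v) ->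
  forall y, y \in A -> S y.

Lemma induced_connect_sym A : connect_sym (induced e A).
Proof.
by apply: sym_connect_sym => u v /=; rewrite /induced /= e_sym andbCA.
Qed.

Lemma connect_closed A (S : pred T) x y :
  (forall u v, u \in A -> v \in A -> e u v -> S u -> S v) ->
  connect (induced e A) x y -> S x -> S y.
Proof.
move=> clS xy Sx.
have cS : closed (induced e A) S.
  apply: intro_closed; first exact: induced_connect_sym.
  by move=> u v /and3P[uA vA uv]; apply: clS.
by rewrite -[S y](closed_connect cS xy).
Qed.

Lemma unseparatedP A : unseparated A <-> #|components e A| <= 1.
Proof.
split=> [uA|/(components_le1P _ e_sym) cA S x xA Sx clS y yA].
  apply/components_le1P => // x y xA yA.
  apply: (uA (connect (induced e A) x) x xA) => // u v uA' vA uv xu.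
  by apply: connect_trans xu _; apply: connect1; rewrite /induced /= uA' vA.
exact: connect_closed clS (cA x y xA yA) Sx.
Qed.

Lemma connectedP A : connected e A <-> A != set0 /\ unseparated A.
Proof.
rewrite connectedE //; split=> [/andP[A0 cA]|[-> /unseparatedP//]].
by split=> //; apply/unseparatedP.
Qed.

(** Cut-vertices need no component count here: for [v] outside [A], [A :\ v] is [A] itself, and for
    a singleton it is empty, which [unseparated] allows. *)
Lemma is_blockP A : is_block e A <->
  [/\ A != set0, unseparated A & forall v, unseparated (A :\ v)].
Proof.
split=> [/andP[cA /forallP nA]|[A0 uA uAv]].
  have /connectedP[A0 uA] := cA; split=> // v.
  have [vA|vA] := boolP (v \in A); last first.
    by rewrite (setDidPl _) // disjoint_sym disjoints1.
  have := nA v; rewrite /cut_vertex vA (eqP cA) /= -leqNgt.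
  by move/unseparatedP.
have cA : connected e A by apply/connectedP.
rewrite /is_block cA; apply/forallP => v.
rewrite /cut_vertex (eqP cA) negb_and -leqNgt; apply/orP; right.
exact/unseparatedP.
Qed.

Lemma connected_neq0 A : connected e A -> A != set0.
Proof. by case/connectedP. Qed.

Lemma is_block_neq0 A : is_block e A -> A != set0.
Proof. by case/andP => /connected_neq0. Qed.

Lemma components_connected A C : C \in components e A -> connected e C.
Proof.
case/imsetP=> x xA ->; apply/connectedP; split.
  by apply/set0Pn; exists x; rewrite inE xA connect0.
move=> S u; rewrite inE => /andP[uA xu] Su clS y /[!inE] /andP[yA xy].
have uy : connect (induced e A) u y.
  by apply: connect_trans xy; rewrite induced_connect_sym.
(* [S] is closed only under edges inside the component, so it is intersected with that component to
   become closed under edges inside [A]. *)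
have clSx a b : a \in A -> b \in A -> e a b ->
    S a && connect (induced e A) x a -> S b && connect (induced e A) x b.
  move=> aA bA ab /andP[Sa xa].
  have xb : connect (induced e A) x b.
    by apply: connect_trans xa _; apply: connect1; rewrite /induced /= aA bA.
  by rewrite xb andbT; apply: (clS a); rewrite ?inE ?aA ?bA.
have /= := connect_closed
  (S := [pred z | S z && connect (induced e A) x z]) clSx uy.
by rewrite Su xu => /(_ isT) /andP[].
Qed.

Lemma connected_sub_component A C : connected e C -> C \subset A ->
  exists2 D, D \in components e A & C \subset D.
Proof.
move=> /connectedP[/set0Pn[x xC] uC] CA.
exists [set y in A | connect (induced e A) x y].
  by apply/imsetP; exists x => //; apply: (subsetP CA).
apply/subsetP => y yC; rewrite inE (subsetP CA) //=.
apply: (uC (connect (induced e A) x) x) => // u v uC' vC uv xu.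
apply: connect_trans xu _; apply: connect1.
by rewrite /induced /= !(subsetP CA).
Qed.

Lemma blocks_block A B : B \in blocks e A -> is_block e B.
Proof. by rewrite inE => /maxsetp/andP[]. Qed.

Lemma is_block_sub_block A C : is_block e C -> C \subset A ->
  exists2 D, D \in blocks e A & C \subset D.
Proof.
move=> bC CA; pose P := [pred D : {set T} | (D \subset A) && is_block e D].
have [|D mD CD] := @maxset_exists _ P C; first by rewrite /= CA.
by exists D; rewrite ?inE.
Qed.

Let comp_proper A C := @components_proper T e A C e_sym.

Lemma td_in_mono A B : A \subset B -> td_in e A <= td_in e B.
Proof.
exact: (depth_mono comp_proper connected_sub_component).
Qed.

Lemma td_in_gt0 A C : connected e C -> C \subset A -> 0 < td_in e A.
Proof.
exact: (depth_gt0 comp_proper connected_sub_component connected_neq0).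
Qed.

Lemma td_in_leS n A : td_in e A <= n.+1 <->
  forall C, C \subset A -> connected e C ->
  exists2 v, v \in C & td_in e (C :\ v) <= n.
Proof.
exact: (depth_leS comp_proper components_connected
  connected_sub_component connected_neq0).
Qed.

Lemma td_in_setD1 A v : td_in e A <= (td_in e (A :\ v)).+1.
Proof.
exact: (depth_setD1 comp_proper components_connected
  connected_sub_component connected_neq0).
Qed.

Lemma td2_in_mono A B : A \subset B -> td2_in e A <= td2_in e B.
Proof.
exact: (depth_mono (@blocks_proper _ e) is_block_sub_block).
Qed.

Lemma td2_in_leS n A : td2_in e A <= n.+1 <->
  forall C, C \subset A -> is_block e C ->
  exists2 v, v \in C & td2_in e (C :\ v) <= n.
Proof.
exact: (depth_leS (@blocks_proper _ e) blocks_block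
  is_block_sub_block is_block_neq0).
Qed.

Lemma td_in_eq0 A : td_in e A <= 0 -> A = set0.
Proof.
rewrite leqn0; apply: contraTeq => /set0Pn[x xA]; rewrite -lt0n.
apply: (@td_in_gt0 _ [set x]); last by rewrite sub1set.
by case/andP: (is_block_set1 x e_sym).
Qed.

Lemma td2_in_eq0 A : td2_in e A <= 0 -> A = set0.
Proof.
rewrite leqn0; apply: contraTeq => /set0Pn[x xA]; rewrite -lt0n.
have bx := is_block_set1 x e_sym.
apply: (depth_gt0 (@blocks_proper _ e) is_block_sub_block is_block_neq0 bx).
by rewrite sub1set.
Qed.

End Connectivity.

(** * Transfer of both depths along induced embeddings *)

Section Embedding.
Variables (T U : finType) (e : rel T) (e' : rel U) (f : T -> U).
Hypotheses (e_sym : symmetric e) (e'_sym : symmetric e').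
Hypotheses (f_inj : injective f) (f_adj : forall x y, e' (f x) (f y) = e x y).
Implicit Types A C : {set T}.

Lemma unseparated_imset A : unseparated e A <-> unseparated e' (f @: A).
Proof.
split=> uA S x.
  move=> /imsetP[a aA ->] Sa clS _ /imsetP[b bA ->].
  apply: (uA (S \o f) a) => // u v uA' vA uv.
  by apply: clS; rewrite ?imset_f ?f_adj.
move=> xA Sx clS y yA.
(* The predicate on the source is pushed forward to its image; injectivity recovers it. *)
suff /imsetP[z] : f y \in f @: [set z | S z] by rewrite inE => Sz /f_inj->.
apply: (uA (mem (f @: [set z | S z])) (f x)); try exact: imset_f.
  by apply: imset_f; rewrite inE.
move=> _ _ /imsetP[a aA ->] /imsetP[b bA ->]; rewrite f_adj => ab.
by rewrite !inE !(mem_imset _ _ f_inj) !inE; apply: clS.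
Qed.

Lemma imset_setD1 A v : f @: (A :\ v) = (f @: A) :\ f v.
Proof.
apply/setP => y; rewrite !inE; apply/imsetP/andP => [[x] |[yv /imsetP[x xA E]]].
  by rewrite !inE => /andP[xv xA] ->; rewrite (inj_eq f_inj) imset_f.
by exists x; rewrite // !inE xA -(inj_eq f_inj) -E yv.
Qed.

Lemma imset_neq0 A : (f @: A != set0) = (A != set0).
Proof. by rewrite imset_eq0. Qed.

Lemma connected_imset A : connected e A -> connected e' (f @: A).
Proof.
move=> /(connectedP e_sym)[A0 /unseparated_imset uA].
by apply/connectedP => //; rewrite imset_neq0.
Qed.

Lemma is_block_imset A : is_block e' (f @: A) -> is_block e A.
Proof.
move=> /(is_blockP e'_sym)[A0 /unseparated_imset uA uAv].
apply/is_blockP => //; split=> // [|v]; first by rewrite -imset_neq0.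
by apply/unseparated_imset; rewrite imset_setD1.
Qed.

Lemma td_in_imset A : td_in e A <= td_in e' (f @: A).
Proof.
move: {-1}(td_in e' _) (leqnn (td_in e' (f @: A))) => n.
elim: n A => [|n IHn] A.
  move/(td_in_eq0 e'_sym)/eqP; rewrite imset_eq0 => /eqP->.
  by rewrite td_in0.
move=> /(td_in_leS e'_sym) H; apply/td_in_leS => // C CA cC.
have [_ /imsetP[v vC ->]] := H _ (imsetS f CA) (connected_imset cC).
by rewrite -imset_setD1 => /IHn; exists v.
Qed.

Lemma td2_in_imset A : td2_in e' (f @: A) <= td2_in e A.
Proof.
move: {-1}(td2_in e _) (leqnn (td2_in e A)) => n.
elim: n A => [|n IHn] A.
  by move/(td2_in_eq0 e_sym)->; rewrite imset0 td2_in0.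
move=> /(td2_in_leS e_sym) H; apply/td2_in_leS => // C CA bC.
(* Blocks inside the image are images of their preimages, so the hypothesis on [A] applies to
   them. *)
have EC : C = f @: (f @^-1: C).
  apply/setP=> y; apply/idP/imsetP => [yC|[x /[!inE] xC ->//]].
  by have /imsetP[x xA yx] := subsetP CA _ yC; exists x; rewrite // inE -yx.
rewrite EC in bC.
have DA : f @^-1: C \subset A.
  apply/subsetP => x; rewrite inE => /(subsetP CA).
  by rewrite mem_imset.
have [v vC /IHn] := H _ DA (is_block_imset bC).
rewrite imset_setD1 -EC => dv; exists (f v) => //.
by move: vC; rewrite inE.
Qed.

End Embedding.

(** * Treedepth and 2-treedepth of a corona *)

Section Corona.
Variables H G : sgraph.

(* The corona of H and G: every vertex h of H, encoded as (h, None), is joined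
   to all vertices of a copy of G of its own, encoded as the (h, Some x). *)
Definition corona_rel : rel (H * option G) := fun p q =>
  match p.2, q.2 with
  | None, None => adj p.1 q.1
  | Some x, Some y => (p.1 == q.1) && adj x y
  | _, _ => p.1 == q.1
  end.

Lemma corona_sym : symmetric corona_rel.
Proof.
by move=> [h [x|]] [h' [y|]]; rewrite /corona_rel /= 1?eq_sym // adj_sym.
Qed.

Lemma corona_irrefl : irreflexive corona_rel.
Proof.
by move=> [h [x|]]; rewrite /corona_rel /= adj_irrefl ?andbF.
Qed.

Definition corona := SGraph corona_sym corona_irrefl.

(** The part of the corona over [A] with every copy of [G] cut down to [X]. The default [true] keeps
    [(h, None)] for all [h] in [A], so connectedness depends on [A] alone. *)
Definition corona_set (A : {set H}) (X : {set G}) : {set corona} :=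
  [set p : corona | (p.1 \in A) && oapp (mem X) true p.2].

Lemma corona_set_connected A X :
  connected (@adj H) A -> connected (@adj corona) (corona_set A X).
Proof.
move=> /(connectedP (@adj_sym H))[/set0Pn[h hA] uA].
apply/(connectedP corona_sym); split.
  by apply/set0Pn; exists (h, None); rewrite inE hA.
move=> S [a o] /[!inE] /= /andP[aA oX] Sa clS [b o'] /[!inE] /= /andP[bA o'X].
have memN c : c \in A -> (c, None) \in corona_set A X.
  by move=> cA; rewrite inE cA.
have SN : S (a, None).
  case: o oX Sa => // x xX Sa; apply: (clS (a, Some x)) => //.
  - by rewrite inE aA.
  - exact: memN.
  - by rewrite /= /corona_rel /=.
have SNb : S (b, None).
  apply: (uA (fun c => S (c, None)) a) => // u v uA' vA uv.
  by apply: clS => //; apply: memN.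
case: o' o'X => // y yX; apply: (clS (b, None)) => //.
- exact: memN.
- by rewrite inE bA.
- by rewrite /= /corona_rel /=.
Qed.

Lemma some_vertex_inj (h : H) : injective (fun x : G => (h, Some x) : corona).
Proof. by move=> x y []. Qed.

Lemma some_vertex_adj (h : H) (x y : G) :
  adj ((h, Some x) : corona) (h, Some y) = adj x y.
Proof. by rewrite /= /corona_rel /= eqxx. Qed.

Lemma none_vertex_inj : injective (fun h : H => (h, None) : corona).
Proof. by move=> x y []. Qed.

(** The vertex [(h, None)] keeps the set connected whatever [X] is. Deleting a copy vertex lowers
    the treedepth of [X] by at most one and leaves a set of the same form; deleting [(h, None)]
    leaves a copy of [X]. *)
Lemma td_corona_set1 h X :
  td_in (@adj G) X < td_in (@adj corona) (corona_set [set h] X).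
Proof.
have ch Y : connected (@adj corona) (corona_set [set h] Y).
  by apply: corona_set_connected; case/andP: (is_block_set1 h (@adj_sym H)).
move: {-1}(td_in (@adj corona) _)
  (leqnn (td_in (@adj corona) (corona_set [set h] X))) => n.
elim: n X => [|n IHn] X.
  by rewrite leqNgt (td_in_gt0 corona_sym (ch X)).
move=> /(td_in_leS corona_sym) /(_ _ (subxx _) (ch X))[[h' [u|]]].
  rewrite !inE /= => /andP[/eqP-> uX] le_n.
  apply: leq_trans (IHn (X :\ u) _); first exact: td_in_setD1 (@adj_sym G) _ _.
  apply: leq_trans le_n; apply: td_in_mono; first exact: corona_sym.
  apply/subsetP => -[a [x|]] /[!inE] /=; rewrite !xpair_eqE ?andbF ?andbT.
    by rewrite !inE -[Some x == _]/(x == u) => /and3P[-> /negPf-> ->].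
  by move=> ->.
rewrite !inE /= andbT => /eqP-> le_n; rewrite ltnS; apply: leq_trans le_n.
apply: leq_trans (td_in_imset (@adj_sym G) corona_sym
  (@some_vertex_inj h) (some_vertex_adj h) X) _.
apply: td_in_mono; first exact: corona_sym.
apply/subsetP => _ /imsetP[x xX ->].
by rewrite !inE /= !xpair_eqE /= !eqxx.
Qed.

(** Deleting any [(h, o)] is charged to deleting [h] from [C], since everything over [C :\ h]
    survives. When [a] is 0, one vertex of [A] with its copy would already exceed [td G]. *)
Lemma td_corona_set a A :
  td_in (@adj corona) (corona_set A setT) <= a + td G -> td_in (@adj H) A <= a.
Proof.
elim: a A => [|a IHa] A le_a.
  suff -> : A = set0 by rewrite td_in0.
  apply: contraTeq le_a => /set0Pn[h hA]; rewrite -ltnNge.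
  apply: leq_trans (td_corona_set1 h setT) _; apply: td_in_mono.
    exact: corona_sym.
  by apply/subsetP => p; rewrite !inE => /andP[/eqP-> ->]; rewrite hA.
apply/(td_in_leS (@adj_sym H)) => C CA cC.
move: le_a; rewrite addSn => /(td_in_leS corona_sym) le_a.
have [|[h o]] := le_a (corona_set C setT) _ (corona_set_connected setT cC).
  by apply/subsetP => p; rewrite !inE => /andP[/(subsetP CA)->].
rewrite inE /= => /andP[hC _] le_n; exists h => //; apply: IHa.
apply: leq_trans le_n; apply: td_in_mono; first exact: corona_sym.
apply/subsetP => -[b o']; rewrite !inE /= xpair_eqE => /andP[/andP[nbh ->] ->].
by rewrite (negPf nbh).
Qed.

Lemma td_corona (h : H) : td H + td G <= td corona.
Proof.
have le_set : td_in (@adj corona) (corona_set setT setT) <= td corona.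
  by apply: td_in_mono; [apply: corona_sym | apply: subsetT].
(* This makes the subtraction [td corona - td G] exact, so that it can serve as [a] in
   [td_corona_set]. *)
have le_G : td G <= td corona.
  apply: leq_trans (ltnW (td_corona_set1 h setT)) _.
  by apply: td_in_mono; [apply: corona_sym | apply: subsetT].
rewrite -[leqRHS](subnK le_G) leq_add2r; apply: td_corona_set.
by rewrite subnK.
Qed.

Lemma corona_block_split B : is_block (@adj corona) B ->
  (forall p, p \in B -> p.2 = None) \/ (exists h, forall p, p \in B -> p.1 = h).
Proof.
move=> /(is_blockP corona_sym)[_ _ uB].
have [/existsP[p]|/existsPn noS] :=
  boolP [exists p : corona, (p \in B) && p.2]; last first.
  by left=> p pB; move: (noS p); rewrite pB; case: p.2.
case: p => h [x|] /=; last (by rewrite andbF); rewrite andbT => hB.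
right; exists h => q qB; apply/eqP/negPn/negP => qh.
suff : (q.1 == h) && q.2 by rewrite (negPf qh).
(* Once [(h, None)] is deleted, the copy vertices over [h] have no neighbours outside their copy, so
   they cannot reach [q]. *)
apply: (uB (h, None) (fun p => (p.1 == h) && p.2) (h, Some x)).
- by rewrite !inE hB xpair_eqE andbF.
- by rewrite eqxx.
- move=> [a [y|]] [b [z|]]; rewrite !inE /= /corona_rel /= ?andbF //.
    by move=> _ _ /andP[/eqP->].
  move=> _ /andP[nb _] /eqP ab /andP[/eqP ah _].
  by rewrite -ab ah xpair_eqE !eqxx in nb.
- by rewrite !inE qB andbT; apply: contraNneq qh => ->.
Qed.

Lemma td2_corona n : td2 H <= n.+1 -> td2 G <= n -> td2 corona <= n.+1.
Proof.
move=> dH dG; apply/(td2_in_leS corona_sym) => B _ bB.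
have B0 := is_block_neq0 corona_sym bB.
have [BN|[h Bh]] := corona_block_split bB.
  have EB : B = (fun h : H => (h, None) : corona) @: [set h | (h, None) \in B].
    apply/setP=> -[h o]; apply/idP/imsetP => [hB|[k] /[!inE] kB -> //].
    by have /= o0 := BN _ hB; rewrite o0 in hB *; exists h; rewrite ?inE.
  have none_adj (x y : H) : adj ((x, None) : corona) (y, None) = adj x y by [].
  move: (bB); rewrite {1}EB => bD.
  have bD' :=
    is_block_imset (@adj_sym H) corona_sym none_vertex_inj none_adj bD.
  have [v] := (td2_in_leS (@adj_sym H) n setT).1 dH _ (subsetT _) bD'.
  rewrite inE => vB dv; exists (v, None) => //.
  rewrite {1}EB -(imset_setD1 none_vertex_inj).
  apply: leq_trans dv.
  exact: (td2_in_imset (@adj_sym H) corona_sym none_vertex_inj none_adj).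
(* The vertex to delete is [(h, None)] if [B] contains it, and any vertex of [B] otherwise. *)
suff [v vB Bv] : exists2 v, v \in B &
    B :\ v \subset (fun x : G => (h, Some x) : corona) @: setT.
  exists v => //; apply: leq_trans (td2_in_mono _ Bv) _.
  apply: leq_trans dG.
  exact: (td2_in_imset (@adj_sym G) corona_sym
    (@some_vertex_inj h) (some_vertex_adj h)).
have sub v : ((h, None) \in B -> v = (h, None)) ->
    B :\ v \subset (fun x : G => (h, Some x) : corona) @: setT.
  move=> vN; apply/subsetP => -[a o]; rewrite !inE => /andP[nv aB].
  have /= ah := Bh _ aB; rewrite ah in aB nv *.
  case: o aB nv => [x|] aB nv; first exact: imset_f.
  by rewrite vN ?eqxx in nv.
have [hB|hB] := boolP ((h, None) \in B).
  by exists (h, None); last exact: sub.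
have /set0Pn[v vB] := B0.
by exists v; last by apply: sub => hB'; rewrite hB' in hB.
Qed.

End Corona.

(** * Induced paths in a corona *)

Lemma has_induced_pathP n (G : sgraph) : has_induced (path_graph n.+1) G <->
  exists g : nat -> G,
    (forall i j, i <= n -> j <= n -> g i = g j -> i = j) /\
    (forall i j, i <= n -> j <= n ->
       adj (g i) (g j) = (i.+1 == j) || (j.+1 == i)).
Proof.
split=> [[f f_inj f_adj]|[g [g_inj g_adj]]].
  exists (fun i => f (inord i)); split=> i j ilt jlt.
    by move=> /f_inj /(congr1 val); rewrite /= !inordK.
  by rewrite f_adj /= /path_rel /= !inordK.
exists (fun i : 'I_n.+1 => g i) => [i j /g_inj eq|i j].
  by apply/val_inj/eq; rewrite -ltnS.
by rewrite g_adj -1?ltnS.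
Qed.

Lemma free_path_leq m n G : m <= n ->
  free (path_graph m) G -> free (path_graph n) G.
Proof.
move=> mn Gm [f f_inj f_adj]; apply: Gm.
exists (fun i => f (widen_ord mn i)) => [i j /f_inj/(congr1 val) eq|i j].
  exact: val_inj.
by rewrite f_adj.
Qed.

(** The only neighbour of a copy vertex outside its copy is the vertex of [H] joined to that whole
    copy. Here that is [p], so every other neighbour of [q] is adjacent to [p]. *)
Lemma corona_adj_closed (H G : sgraph) (p q r : corona H G) :
  p.2 = None -> q.2 != None -> adj p q -> adj q r -> r <> p -> adj p r.
Proof.
case: p q r => [a o] [b [x|]] [c [y|]] //= ->; rewrite /corona_rel //= => _.
  by move=> /eqP-> /andP[].
by move=> /eqP-> /eqP->.
Qed.

Lemma free_path_corona n (H G : sgraph) :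
  free (path_graph n.+1) H -> free (path_graph n.+3) G ->
  free (path_graph n.+3) (corona H G).
Proof.
move=> Hfree Gfree /has_induced_pathP[g [g_inj g_adj]].
(* For consecutive [p], [q], [r] on the path with [g p] in [H], a copy vertex at [q] would force the
   chord from [g p] to [g r]. *)
have step p q r : p <= n.+2 -> q <= n.+2 -> r <= n.+2 ->
    (p.+1 == q) || (q.+1 == p) -> (q.+1 == r) || (r.+1 == q) -> p != r ->
    (g p).2 = None -> (g q).2 = None.
  move=> lep leq ler pq qr pr gp; apply/eqP/contraT => gq.
  have : adj (g p) (g r).
    apply: corona_adj_closed gp gq _ _ _; rewrite ?g_adj // => /g_inj rp.
    by rewrite rp ?eqxx in pr.
  rewrite g_adj //; move: pq qr pr.
  by case/orP=> /eqP<-; case/orP=> /eqP;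
    move=> E; rewrite ?eqSS ?eqn_leq in E *; lia.
have pair_ext (p q : corona H G) : p.1 = q.1 -> p.2 = q.2 -> p = q.
  by case: p q => [? ?] [? ?] /= -> ->.
have [/existsP[j /eqP gj]|/existsPn gS] :=
  boolP [exists j : 'I_n.+3, (g j).2 == None].
  have ltj : j <= n.+2 by rewrite -ltnS.
  have up d : j + d <= n.+1 -> (g (j + d)).2 = None.
    elim: d => [|d IHd] le; first by rewrite addn0.
    rewrite addnS in le *.
    by apply: (step (j + d) _ (j + d).+2); rewrite ?eqxx ?IHd //; lia.
  have down d : d < j -> (g (j - d)).2 = None.
    elim: d => [|d IHd] lt; first by rewrite subn0.
    by apply: (step (j - d) _ (j - d.+2)); rewrite ?IHd //; lia.
  (* A single path vertex in [H] thus forces all positions except possibly 0 and [n.+2] into [H].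
     The remaining [n.+1] positions form an induced path of [H]. *)
  have gN i : i <= n -> (g i.+1).2 = None.
    move=> le_i; have [le_ji|lt_ij] := leqP j i.+1.
      by rewrite -(subnKC le_ji); apply: up; rewrite subnKC.
    by rewrite -(subKn (ltnW lt_ij)); apply: down; lia.
  apply: Hfree; apply/has_induced_pathP; exists (fun i => (g i.+1).1).
  split=> i j' lei lej.
    by move=> eq1; apply/succn_inj/g_inj/pair_ext; rewrite ?gN // ltnS leqW.
  have := g_adj i.+1 j'.+1 (leqW lei) (leqW lej); rewrite !eqSS => <-.
  by rewrite /= /corona_rel !gN.
have gSome i : i <= n.+2 -> exists x, (g i).2 = Some x.
  move=> le_i; move: (gS (Ordinal (le_i : i < n.+3))) => /=.
  by case: (g i).2 => // x _; exists x.
have [x0 _] := gSome 0 isT.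
(* A path that avoids [H] cannot change copies, as adjacent copy vertices share their first
   coordinate. *)
have gh i : i <= n.+2 -> (g i).1 = (g 0).1.
  elim: i => // i IHi le_i; have le_i' := ltnW le_i; rewrite -(IHi le_i').
  have := g_adj i i.+1 le_i' le_i; rewrite eqxx /= /corona_rel.
  have [x ->] := gSome i le_i'; have [y ->] := gSome i.+1 le_i.
  by case/andP=> /eqP->.
apply: Gfree; apply/has_induced_pathP; exists (fun i => odflt x0 (g i).2).
split=> i j le_i le_j; have [x gi] := gSome i le_i; have [y gj] := gSome j le_j.
  by rewrite gi gj /= => xy; apply/g_inj/pair_ext; rewrite ?gi ?gj ?xy ?gh.
by rewrite -g_adj //= /corona_rel gi gj !gh // eqxx.
Qed.

(** * The iterated coronas and their parameters *)

Definition singleton_graph :=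
  @SGraph unit (fun _ _ => false) (fun _ _ => erefl) (fun _ => erefl).

(** Indexed so that treedepth follows Pascal's rule for ['C(s + k, s)]. The inner fixpoint is there
    because the recursion is lexicographic: one call lowers [s], the other keeps [s] and lowers
    [k]. *)
Fixpoint iterated_corona s k : sgraph :=
  if s is s'.+1 then
    (fix corona_row k := if k is k'.+1
       then corona (iterated_corona s' k) (corona_row k')
       else singleton_graph) k
  else singleton_graph.

Lemma iterated_coronaS s k : iterated_corona s.+1 k.+1 =
  corona (iterated_corona s k.+1) (iterated_corona s.+1 k).
Proof. by []. Qed.

Lemma iterated_corona_vertex s k : inhabited (iterated_corona s k).
Proof.
elim: s k => [|s IHs] [|k]; try by constructor; exact: tt.
by have [h] := IHs k.+1; constructor; exact: (h, None).
Qed.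

Lemma td_singleton : 0 < td singleton_graph.
Proof.
rewrite lt0n; apply/eqP => td0.
have /setP/(_ tt) : [set: singleton_graph] = set0.
  by apply: td_in_eq0; [apply: adj_sym | rewrite -/(td _) td0].
by rewrite !inE.
Qed.

Lemma td_iterated_corona s k : 'C(s + k, s) <= td (iterated_corona s k).
Proof.
elim: s k => [|s IHs] k; first by rewrite bin0 td_singleton.
elim: k => [|k IHk]; first by rewrite addn0 binn td_singleton.
have [h] := iterated_corona_vertex s k.+1.
rewrite iterated_coronaS; apply: leq_trans (td_corona _ h).
rewrite addSn binS addnC leq_add //.
by rewrite addnS -addSn.
Qed.

Lemma td2_iterated_corona s k : td2 (iterated_corona s k) <= k.+1.
Proof.
have td2_singleton n : td2 singleton_graph <= n.+1.
  apply/td2_in_leS => [|C _ /is_block_neq0/set0Pn]; first exact: adj_sym.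
  case=> [|v vC]; first exact: adj_sym.
  exists v => //; suff -> : C :\ v = set0 by rewrite td2_in0.
  by apply/setP => u; rewrite !inE; case: u v {vC} => -[].
elim: s k => [|s IHs] k; first exact: td2_singleton.
elim: k => [|k IHk]; first exact: td2_singleton.
by rewrite iterated_coronaS; apply: td2_corona.
Qed.

(** In row 1 the base of each corona is a single vertex, so each step adds one universal vertex. *)
Lemma iterated_corona1_complete k (x y : iterated_corona 1 k) :
  x != y -> adj x y.
Proof.
elim: k x y => [|k IHk]; first by move=> [] [].
move=> [[] [x|]] [[] [y|]] //; rewrite xpair_eqE /= /corona_rel /=.
exact: IHk.
Qed.

(** Row 1 is complete, hence free of the path on 3 vertices, and each further row costs two path
    vertices. Row 0 does not fit the pattern: its single vertex contains the path on 1 vertex. *)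
Lemma free_path_iterated_corona s k :
  free (path_graph s.*2.+3) (iterated_corona s.+1 k).
Proof.
elim: s k => [|s IHs] k.
  move=> /has_induced_pathP[g [g_inj g_adj]].
  have : ~~ adj (g 0) (g 2) by rewrite g_adj.
  rewrite iterated_corona1_complete //.
  by apply/eqP => /(g_inj 0 2 isT isT).
elim: k => [|k IHk].
  move=> /has_induced_pathP[g [g_inj _]].
  suff /(g_inj 0 1 isT isT) : g 0 = g 1 by [].
  by case: (g 0) (g 1) => -[].
rewrite iterated_coronaS doubleS; exact: free_path_corona.
Qed.

Theorem theorem2 (t k : nat) (ht : 2 <= t) (hk : 1 <= k) :
  exists G : sgraph,
    [/\ free (path_graph t) G,
        td2 G <= k &
        'C((t - 1) %/ 2 + k - 1, (t - 1) %/ 2) <= td G].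
Proof.
case: k hk => // k _; rewrite addnS subn1 /=.
exists (iterated_corona ((t - 1) %/ 2) k); split.
(* Row 0 occurs only for [t = 2], where a one-vertex graph suffices. In row [s.+1] the quotient
   gives [s.*2.+3 <= t]. *)
- case E: ((t - 1) %/ 2) => [|s].
    apply: (@free_path_leq 2) => // /has_induced_pathP[g [g_inj _]].
    suff /(g_inj 0 1 isT isT) : g 0 = g 1 by [].
    by case: (g 0) (g 1) => -[].
  by apply: free_path_leq (@free_path_iterated_corona s k); lia.
- exact: td2_iterated_corona.
- exact: td_iterated_corona.
Qed.
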